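(* If $z<1$, then $E$ is not bounded below on $\mathcal{X}_1$, and hence $E$ admits no minimiser on $\mathcal{X}_1$.
   Context: Let $z\in\mathbb{R}$ be the charge ratio. $H^1$ is the space of functions $u:\mathbb{R}\to\mathbb{R}$ with $\|u'\|_2^2+\|u\|_2^2<\infty$; $\mathcal{X}=\{u\in H^1:\int_{\mathbb{R}}|x|u(x)^2\,dx<\infty\}$; $\mathcal{X}_1=\{u\in\mathcal{X}:\|u\|_2=1\}$. The energy (for a point charge background $\rho=-z\delta_0$) is $$E[u]=\int_{\mathbb{R}}|u'(x)|^2\,dx-\frac12\int_{\mathbb{R}}\int_{\mathbb{R}}|x-y|\,u(x)^2u(y)^2\,dx\,dy+z\int_{\mathbb{R}}|x|\,u(x)^2\,dx .$$ *)

(* Defs.v *)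
From HB Require Import structures.
From mathcomp Require Import all_boot all_order all_algebra.
From mathcomp Require Import all_classical all_reals all_analysis.
Set Implicit Arguments.
Unset Strict Implicit.
Unset Printing Implicit Defensive.
Import Order.TTheory GRing.Theory Num.Theory.
Import numFieldNormedType.Exports.
Local Open Scope classical_set_scope.
Local Open Scope ring_scope.

Section ChargedGas.
Context {R : realType}.
Implicit Types (u v phi : R -> R).

Local Notation mu := (@lebesgue_measure R).

(* C_c^oo(R) *)
Definition test_function : set (R -> R) :=
  [set phi | (forall (n : nat) (x : R), derivable (phi^`(n))%classic x 1) /\
             compact (closure [set x | phi x != 0])].

(* All the integrals below are finite, the integrands being locally integrable
   functions times bounded functions with compact support. *)
Definition is_weak_derivative u v : Prop :=
  [/\ locally_integrable setT u, locally_integrable setT v &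
      forall phi, test_function phi ->
        \int[mu]_x (u x * (phi^`())%classic x) = - \int[mu]_x (v x * phi x)].

(* A representative of the weak derivative of u, which is unique up to equality
   almost everywhere; the zero function if u is not weakly differentiable. *)
Definition weak_derivative u : R -> R :=
  xget (cst 0) [set v | is_weak_derivative u v].

(* Elements are measurable functions, not classes modulo equality a.e. *)
Definition H1 : set (R -> R) :=
  [set u | [/\ u \in Lfun mu 2%:E, exists v, is_weak_derivative u v &
               weak_derivative u \in Lfun mu 2%:E]].

Definition X : set (R -> R) :=
  [set u | H1 u /\ (\int[mu]_x (`|x| * u x ^+ 2)%:E < +oo)%E].

Definition X1 : set (R -> R) :=
  [set u | X u /\ 'N[mu]_2%:E[EFin \o u]%E = 1%E].

(* The real-valued integrals are meaningful on X, where all of them converge;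
   Rintegral returns 0 for a divergent integral, which only happens off X. *)
Definition energy (z : R) u : R :=
  \int[mu]_x (`|weak_derivative u x| ^+ 2)
  - 2^-1 * \int[mu]_x (\int[mu]_y (`|x - y| * u x ^+ 2 * u y ^+ 2))
  + z * \int[mu]_x (`|x| * u x ^+ 2).

End ChargedGas.

(* Main.v *)
Require Import Defs.
From HB Require Import structures.
From mathcomp Require Import all_boot all_order all_algebra.
From mathcomp Require Import all_classical all_reals all_analysis.
From mathcomp Require Import measurable_realfun ring lra.
Import Order.TTheory GRing.Theory Num.Theory.
Import numFieldNormedType.Exports.
Local Open Scope classical_set_scope.
Local Open Scope ring_scope.

(** The energy falls to minus infinity when the charge is split into two
lumps that are moved apart. Let phi be a smooth bump supported in [-1, 1] with
unit L2 norm, and put u(x) = a phi(x) + b phi(x - L) with a^2 + b^2 = 1 and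
L >= 2. The two lumps have disjoint supports, so u has unit norm and the kinetic
energy is that of phi, whatever L is ([pair_kinetic]). The background acts only
on the lump of mass b^2 that sits near L, and it contributes b^2 z L up to the
constant |z| ([pair_moment]); the repulsion of the two lumps contributes
- a^2 b^2 (L - 2) or less ([pair_interaction]). Hence
E[u] <= C - b^2 (a^2 - z) L with C independent of L ([pair_energy]). As z < 1,
some small b > 0 gives a^2 = 1 - b^2 > z, and letting L grow makes E[u] tend
to minus infinity. A minimiser would provide a lower bound.

The energy refers to some weak derivative of u, chosen arbitrarily, so the
computation with the classical derivative has to be justified: integration by
parts shows that the classical derivative of u is a weak derivative, and two
weak derivatives agree almost everywhere by the fundamental lemma of the
calculus of variations ([fundamental_lemma]). The latter needs a supply of test
functions: bumps built from y^-k exp(-1/y) which converge boundedly to the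
indicator of any given open interval ([window_cvg]). *)

(** * Smooth bumps *)

Section SmoothBumps.
Context {R : realType}.
Implicit Types (f g : R -> R) (p q : {poly R}) (x y c : R) (k n : nat).

Definition smooth f := forall n x, derivable (derive1n n f) x 1.

(** Membership in a class closed under differentiation is a certificate of
smoothness, so that no formula for the higher derivatives is needed. *)
Lemma smooth_coind (C : set (R -> R)) :
  (forall f, C f -> (forall x, derivable f x 1) /\ C (derive1 f)) ->
  forall f, C f -> smooth f.
Proof.
move=> HC f Cf n.
suff : C (derive1n n f) by move=> /HC[].
elim: n => [//|n IH]; rewrite derive1nS; exact: (HC _ IH).2.
Qed.

Lemma smooth_derivable f : smooth f -> forall x, derivable f x 1.
Proof. by move=> sf; exact: (sf 0%N). Qed.

Lemma smooth_derive1 f : smooth f -> smooth (derive1 f).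
Proof. by move=> sf n x; rewrite -derive1Sn; exact: sf. Qed.

Lemma derivable_continuous f : (forall x, derivable f x 1) -> continuous f.
Proof. by move=> df x; apply/differentiable_continuous/derivable1_diffP. Qed.

Lemma is_derive_comb f g (a b c x : R) :
  derivable f x 1 -> derivable g (x - c) 1 ->
  is_derive x 1 (fun x => a * f x + b * g (x - c))
    (a * (derive1 f) x + b * (derive1 g) (x - c)).
Proof.
move=> df dg.
have hf : is_derive x 1 f (derive1 f x) by rewrite derive1E; apply: DeriveDef.
have hg : is_derive (x - c) 1 g (derive1 g (x - c)).
  by rewrite derive1E; apply: DeriveDef.
have hs : is_derive x 1 (fun x => x - c) 1.
  by rewrite -[X in is_derive _ _ _ X]subr0; apply: is_deriveB.
have hgs := @is_derive1_comp _ g _ x _ _ hg hs.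
rewrite (_ : (fun _ => _) = a \*: f + b \*: (g \o (fun x => x - c))) //.
rewrite -[derive1 g _]mulr1.
exact: (@is_deriveD R R R (a \*: f) (b \*: _) x 1 _ _
  (is_deriveZ a hf) (is_deriveZ b hgs)).
Qed.

Lemma derive1_comb f g (a b c : R) :
  (forall x, derivable f x 1) -> (forall x, derivable g x 1) ->
  derive1 (fun x => a * f x + b * g (x - c)) =
  (fun x => a * (derive1 f) x + b * (derive1 g) (x - c)).
Proof.
move=> df dg; apply/funext => x; rewrite derive1E.
by have h := is_derive_comb f g a b c x (df x) (dg (x - c)); rewrite derive_val.
Qed.

Lemma smooth_comb f g (a b c : R) : smooth f -> smooth g ->
  smooth (fun x => a * f x + b * g (x - c)).
Proof.
move=> sf sg; apply: (smooth_coind [set h | exists f g, [/\ smooth f, smooth g &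
  h = (fun x => a * f x + b * g (x - c))]]); last by exists f, g.
move=> _ [{}f [{}g [{}sf {}sg ->]]]; split => [x|].
  by have [] := is_derive_comb f g a b c x (smooth_derivable _ sf _)
    (smooth_derivable _ sg _).
exists (derive1 f), (derive1 g); split; [exact: smooth_derive1..|].
by apply: derive1_comb; exact: smooth_derivable.
Qed.

(** For k = 0, the standard smooth function that vanishes to infinite order at 0;
the negative powers make the family closed under differentiation. *)
Definition flat k y : R := if 0 < y then y ^- k * expR (- y^-1) else 0.

Lemma flatS k y : flat k y = y * flat k.+1 y.
Proof.
rewrite /flat; case: ifPn => [y0|_]; last by rewrite mulr0.
by rewrite mulrA exprS invfM mulrA divff ?mul1r// gt_eqF.
Qed.

Lemma flat_le0 k y : y <= 0 -> flat k y = 0.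
Proof. by rewrite /flat leNgt => /negbTE ->. Qed.

Lemma flat_ge0 k y : 0 <= flat k y.
Proof.
rewrite /flat; case: ifPn => // y0; rewrite mulr_ge0 ?expR_ge0//.
by rewrite invr_ge0 exprn_ge0// ltW.
Qed.

(** With t = 1/y this is t^(k+2) <= (k+2)! e^t, a term of the exponential series.
The quadratic bound is what gives a zero derivative at the origin. *)
Lemma flat_le_sqr k y : flat k y <= (k.+2)`!%:R * y ^+ 2.
Proof.
rewrite /flat; case: ifPn => [y0|_]; last by rewrite mulr_ge0 ?sqr_ge0.
have t0 : 0 < y^-1 by rewrite invr_gt0.
have := expR_ge1Dxn k.+1 (ltW t0).
move=> h; have {}h : y^-1 ^+ k.+2 / (k.+2)`!%:R <= expR y^-1.
  by rewrite (le_trans _ h)// lerDr.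
rewrite expRN ler_pdivrMr ?expR_gt0//.
move: h; rewrite ler_pdivrMr ?ltr0n ?fact_gt0// => h.
have -> : y ^- k = y ^+ 2 * y^-1 ^+ k.+2.
  by rewrite -exprVn -[k.+2]addn2 exprD mulrCA -exprMn divff ?gt_eqF// expr1n mulr1.
by rewrite [leRHS](_ : _ = y ^+ 2 * (expR y^-1 * (k.+2)`!%:R)) ?ler_pM2l ?exprn_gt0//; ring.
Qed.

(** For y > 0 this is calculus; at y <= 0 the difference quotient at increment h
is at most (k+2)! |h|, since flat(y + h) is nonzero only if 0 < y + h <= h. *)
Lemma is_derive_flat k y :
  is_derive y 1 (flat k) (flat k.+2 y - k%:R * flat k.+1 y).
Proof.
have [y0|y0] := ltP 0 y.
  apply: (@near_eq_is_derive _ _ _ (fun y => y ^- k * expR (- y^-1))).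
    near=> u; rewrite /flat ifT//; near: u; exact: lt_nbhsr.
  have yn0 : y != 0 by rewrite gt_eqF.
  have hV : is_derive y 1 (fun y : R => y^-1) (- y ^- 2).
    apply: is_derive_eq; first exact: (@is_deriveV R id y 1 1).
    by rewrite -[RHS]mulr1.
  have h1 : is_derive y 1 ((fun y : R => y^-1) ^+ k)
      ((k%:R * y^-1 ^+ k.-1) *: (- y ^- 2)).
    exact: (@is_deriveX R R (fun y : R => y^-1)).
  have h2 : is_derive y 1 (fun y : R => expR (- y^-1))
      (expR (- y^-1) * (y ^- 2)).
    apply: (@is_derive1_comp _ expR (fun y : R => - y^-1)).
    by rewrite -[y ^- 2]opprK; exact: (@is_deriveN R R R _ y 1 _ hV).
  rewrite (_ : (fun _ => _) =
    ((fun y : R => y^-1) ^+ k) * (fun y : R => expR (- y^-1))); last first.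
    by apply/funext => u /=; rewrite /GRing.mul /= exprfctE exprVn.
  apply: is_derive_eq.
  rewrite /flat y0 exprfctE -!exprVn.
  set e := expR _; set t := y^-1.
  rewrite /GRing.scale /=.
  case: (k) => [|m] /=; rewrite -?exprVn -?/t.
    by rewrite !mul0r mulr0 addr0 subr0 expr0 mul1r mulrC.
  by rewrite !exprS; ring.
rewrite !(flat_le0 _ _ y0) mulr0 subr0.
have n0 : (k.+2)`!%:R * `|h| @[h --> (0 : R)^'] --> (0 : R).
  rewrite -[X in _ --> X](mulr0 (k.+2)`!%:R); apply: cvgMr.
  rewrite -[X in _ --> X](@normr0 _ R); apply: cvg_norm; exact: cvg_within.
have L : (fun h => h^-1 *: (flat k (h *: 1 + y) - flat k y)) @ 0^' --> (0 : R).
  apply: (@squeeze_cvgr _ _ _ _ (fun h : R => - ((k.+2)`!%:R * `|h|))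
     (fun h : R => (k.+2)`!%:R * `|h|)).
  - near=> h; rewrite -ler_norml (flat_le0 _ _ y0) subr0 /GRing.scale /= mulr1.
    have h0 : h != 0 by near: h; exact: nbhs_dnbhs_neq.
    rewrite normrM normfV ler_pdivrMl ?normr_gt0// mulrCA -expr2.
    rewrite ger0_norm ?flat_ge0//.
    have [hy|hy] := leP (h + y) 0; first by rewrite flat_le0// mulr_ge0 ?sqr_ge0.
    rewrite (le_trans (flat_le_sqr _ _))// ler_wpM2l//.
    rewrite real_normK ?num_real//.
    rewrite ler_pXn2r ?nnegrE//; lra.
  - by rewrite -[X in _ --> X]oppr0; exact: cvgN.
  - exact: n0.
apply: DeriveDef; first by apply/cvg_ex; exists 0.
by apply: cvg_lim => //.
Unshelve. all: by end_near. Qed.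

(** Supported where q > 0. Keeping a polynomial factor p makes these functions
stable under differentiation with q fixed. *)
Definition poly_bump p k q x := p.[x] * flat k q.[x].

(** The identity flat k y = y flat (k+1) y brings the terms of the chain rule to
the common index k + 2, hence back to a single function of the family. *)
Lemma is_derive_poly_bump p k q x : is_derive x 1 (poly_bump p k q)
  (poly_bump (p^`() * q ^+ 2 - k%:R *: (p * q^`() * q) + p * q^`())%R k.+2 q x).
Proof.
have h1 : is_derive x 1 (fun x => flat k q.[x])
    ((flat k.+2 q.[x] - k%:R * flat k.+1 q.[x]) * q^`().[x]).
  apply: (@is_derive1_comp _ (flat k) (horner q)); exact: is_derive_flat.
rewrite (_ : poly_bump p k q = horner p * (fun x => flat k q.[x])) //.
apply: is_derive_eq.
rewrite /poly_bump /GRing.scale /= (flatS k) (flatS k.+1) !hornerE /=.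
by ring.
Qed.

Lemma smooth_poly_bump p k q : smooth (poly_bump p k q).
Proof.
apply: (smooth_coind [set f | exists p k, f = poly_bump p k q]); last by exists p, k.
move=> _ [{}p [{}k ->]]; split=> [x|]; first by have [] := is_derive_poly_bump p k q x.
eexists; eexists; apply/funext => x; rewrite derive1E.
by have h := is_derive_poly_bump p k q x; rewrite derive_val.
Qed.

End SmoothBumps.

(** * Test functions *)

Section TestFunctions.
Context {R : realType}.
Local Notation mu := (@lebesgue_measure R).
Implicit Types (f g u phi : R -> R) (M : R).

(** The closed condition M <= |x| makes f vanish at the ends of [-M, M] too, which
kills the boundary terms in integrations by parts. *)
Definition vanish_off M f := forall x, M <= `|x| -> f x = 0.

Lemma vanish_off_le M N f : M <= N -> vanish_off M f -> vanish_off N f.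
Proof. by move=> MN fM x Nx; apply: fM; exact: le_trans Nx. Qed.

Lemma segment_integrable M f : vanish_off M f ->
  mu.-integrable `[- M, M] (EFin \o f) -> mu.-integrable setT (EFin \o f).
Proof.
move=> fM.
have mI : measurable (`[- M, M]%classic : set (measurableTypeR R)).
  exact: measurable_itv.
rewrite (integrable_mkcond _ mI); congr integrable.
apply/funext => x; rewrite patchE; case: ifPn => //= /negP xM.
rewrite fM// leNgt; apply/negP => /ltW; rewrite ler_norml => xM'.
by apply: xM; rewrite inE /= in_itv.
Qed.

Lemma continuous_integrable M f :
  continuous f -> vanish_off M f -> mu.-integrable setT (EFin \o f).
Proof.
move=> cf fM; apply: (segment_integrable M) => //.
apply: continuous_compact_integrable; first exact: segment_compact.
exact: continuous_subspaceT.
Qed.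

Lemma test_functionI M f : smooth f -> vanish_off M f -> test_function f.
Proof.
move=> sf fM; split; first exact: sf.
apply: (@subclosed_compact _ _ (`[- M, M]%classic : set R)).
- exact: closed_closure.
- exact: segment_compact.
- have cI : closed (`[- M, M]%classic : set R) by exact: interval_closed.
  rewrite [X in _ `<=` X]((closure_id _).1 cI).
  apply: closure_subset => x /= fx0; rewrite in_itv /= -ler_norml leNgt.
  by apply: contra_neqN fx0 => /ltW /fM.
Qed.

Lemma test_function_smooth f : test_function f -> smooth f.
Proof. by case. Qed.

Lemma vanish_off_derive1 M f : vanish_off M f -> vanish_off (M + 1) (derive1 f).
Proof.
move=> fM x Mx; rewrite derive1E (@near_eq_derive _ _ _ _ (cst 0)).
  by rewrite derive_cst.
have Mx' : M < `|x| by rewrite (lt_le_trans _ Mx)// ltrDl.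
near=> y; apply: fM; apply: ltW; near: y.
have : (`|y| @[y --> x] --> `|x|) by apply: cvg_norm.
by move/cvgr_gt; apply.
Unshelve. all: by end_near. Qed.

Lemma test_function_vanish phi : test_function phi ->
  exists M, [/\ 0 < M, vanish_off M phi & vanish_off M (derive1 phi)].
Proof.
move=> [_ /compact_bounded [N [_ HN]]].
have v : vanish_off (`|N| + 2) phi.
  move=> x Nx; apply/eqP; apply: contraT => px.
  have /HN : N < `|N| + 1 by rewrite (le_lt_trans (ler_norm N))// ltrDl.
  move=> /(_ x) h; have {h} : `|x| <= `|N| + 1.
    by apply: h; exact: subset_closure.
  by rewrite leNgt (lt_le_trans _ Nx)// ltrD2l ltr1n.
exists (`|N| + 2 + 1); split.
- by rewrite addr_gt0// ltr_wpDl.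
- by apply: vanish_off_le v; rewrite lerDl.
- exact: vanish_off_derive1.
Qed.

Lemma test_function_comb f g (a b c : R) : test_function f -> test_function g ->
  test_function (fun x => a * f x + b * g (x - c)).
Proof.
move=> tf tg; have [M [M0 fM _]] := test_function_vanish _ tf.
have [N [N0 gN _]] := test_function_vanish _ tg.
apply: (test_functionI (M + N + `|c|)).
  by apply: smooth_comb; exact: test_function_smooth.
move=> x xM; rewrite fM ?gN ?mulr0 ?addr0//.
- have := lerB_dist x c; rewrite lerBlDr => /(le_trans xM).
  by rewrite lerD2r => /(le_trans _); apply; rewrite lerDr ltW.
- by rewrite (le_trans _ xM)// -addrA lerDl addr_ge0// ltW.
Qed.

Lemma poly_bump_test_function (p q : {poly R}) (k : nat) M :
  (forall x, M <= `|x| -> q.[x] <= 0) -> test_function (poly_bump p k q).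
Proof.
move=> qM; apply: (test_functionI M); first exact: smooth_poly_bump.
by move=> x /qM qx; rewrite /poly_bump flat_le0 ?mulr0.
Qed.

Lemma smooth_continuous f : smooth f -> continuous f.
Proof. by move=> sf; apply: derivable_continuous; exact: smooth_derivable. Qed.

End TestFunctions.

(** * The fundamental lemma of the calculus of variations *)

Section FundamentalLemma.
Context {R : realType}.
Local Notation mu := (@lebesgue_measure R).
Implicit Types (f g u v w phi : R -> R) (M a b : R).

(** The profile exp(-1/((n+1)(x-a)(b-x))) on the interval between a and b: the
factor n+1 flattens it to 1 in the limit. *)
Definition window a b n : R -> R :=
  poly_bump 1 0 (n.+1%:R *: (('X - a%:P) * (b%:P - 'X))).

Lemma window_poly a b n (x : R) :
  (n.+1%:R *: (('X - a%:P) * (b%:P - 'X)) : {poly R}).[x] =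
  n.+1%:R * ((x - a) * (b - x)).
Proof. by rewrite !hornerE. Qed.

Lemma window_in a b n x : a < x < b ->
  window a b n x = expR (- (n.+1%:R^-1 * ((x - a) * (b - x))^-1)).
Proof.
move=> /andP[ax xb]; rewrite /window /poly_bump window_poly hornerE mul1r /flat.
by rewrite ifT ?mulr_gt0 ?subr_gt0// expr0 invr1 mul1r invfM.
Qed.

(** Without a <= b the quadratic would be positive between b and a. *)
Lemma window_out a b n x : a <= b -> ~~ (a < x < b) -> window a b n x = 0.
Proof.
move=> ab xab; rewrite /window /poly_bump window_poly flat_le0 ?mulr0//.
rewrite pmulr_rle0// leNgt; apply/negP => h; move: xab.
have [xa|ax] := leP x a; have [bx|xb] := leP b x => // _; nra.
Qed.

Lemma window_bound a b n x : a <= b -> 0 <= window a b n x <= 1.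
Proof.
move=> ab; have [xab|xab] := boolP (a < x < b); last by rewrite window_out// lexx ler01.
rewrite window_in// expR_ge0/= -expR0 ler_expR oppr_le0.
move/andP: xab => [ax xb].
by rewrite mulr_ge0// invr_ge0 mulr_ge0// subr_ge0 ltW.
Qed.

Lemma window_test_function a b n : test_function (window a b n).
Proof.
apply: (poly_bump_test_function _ _ _ (`|a| + `|b|)) => x xM.
rewrite window_poly pmulr_rle0//.
have := ler_norm a; have := ler_norm b.
have := ler_norm (- a); have := ler_norm (- b); rewrite !normrN.
have [x0|x0] := leP 0 x; rewrite ?(ger0_norm x0) ?(ltr0_norm x0) in xM.
  by move=> ? ? ? ?; rewrite mulr_ge0_le0//; lra.
by move=> ? ? ? ?; rewrite mulr_le0_ge0//; lra.
Qed.

Lemma window_cvg a b x : a <= b ->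
  window a b n x @[n --> \oo] --> (\1_(`]a, b[%classic : set R) x : R).
Proof.
move=> ab; rewrite indicE mem_setE /= in_itv /=.
have [xab|xab] := boolP (a < x < b); last first.
  rewrite (_ : (fun _ => _) = cst 0); first exact: cvg_cst.
  by apply/funext => n; rewrite window_out.
rewrite (_ : (fun _ => _) =
  (fun n => expR (- (n.+1%:R^-1 * ((x - a) * (b - x))^-1)))); last first.
  by apply/funext => n; rewrite window_in.
rewrite -[X in _ --> X]expR0; apply: continuous_cvg; first exact: continuous_expR.
rewrite -oppr0; apply: cvgN.
rewrite -[X in _ --> X](mul0r ((x - a) * (b - x))^-1).
apply: cvgMl; exact: cvg_harmonic.
Qed.

Lemma locally_integrable_segment w a b : locally_integrable setT w ->
  mu.-integrable `[a, b] (EFin \o w).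
Proof.
move=> [mw _ cw]; apply/integrableP; split.
  by apply/measurable_EFinP; exact: measurable_funTS.
by apply: cw => //; exact: segment_compact.
Qed.

Lemma locally_integrable_mul M phi w :
  locally_integrable setT w -> continuous phi -> vanish_off M phi ->
  mu.-integrable setT (EFin \o (fun x => w x * phi x)).
Proof.
move=> lw cphi vphi; apply: (segment_integrable M).
  by move=> x /vphi ->; rewrite mulr0.
apply: (integrableMl _ (locally_integrable_segment _ (- M) M lw)).
- exact: measurable_itv.
- by apply: measurable_funTS; exact: continuous_measurable_fun.
- have cT := continuous_subspaceT (A := `[- M, M]%classic) cphi.
  have /compact_bounded[K [_ mrt]] :=
    continuous_compact cT (@segment_compact _ _ _).
  by exists K; split; rewrite ?num_real // => ? ? ? ?; exact: mrt.
Qed.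

(** Test against the windows of ]a, b[ and pass to the limit by dominated
convergence, with bound |w| on ]a, b[. *)
Lemma fundamental_lemma_itv w a b : locally_integrable setT w ->
  (forall phi, test_function phi -> \int[mu]_x (w x * phi x) = 0) ->
  (\int[mu]_(x in `]a, b[) (w x)%:E = 0)%E.
Proof.
move=> lw w0; have [ba|ab] := leP b a.
  by rewrite set_itv_ge ?integral_set0// bnd_simp -leNgt.
have mI : measurable (`]a, b[%classic : set (measurableTypeR R)).
  exact: measurable_itv.
have iw : mu.-integrable `]a, b[ (EFin \o w).
  apply: integrableS (locally_integrable_segment w a b lw) => //.
  exact: subset_itv_oo_cc.
have ig := (integrable_mkcond _ mI).1 (integrable_abse iw).
have vM n : vanish_off (`|a| + `|b|) (window a b n).
  move=> x xM; apply: window_out; first exact: ltW.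
  apply/negP => /andP[ax xb].
  have := ler_norm b; have := ler_norm (- a); rewrite normrN.
  have := normr_ge0 a; have := normr_ge0 b.
  by have [x0|x0] := leP 0 x; rewrite ?(ger0_norm x0) ?(ltr0_norm x0) in xM; lra.
have iwn n := locally_integrable_mul _ _ _ lw
  (smooth_continuous _ (test_function_smooth _ (window_test_function a b n)))
  (vM n).
have [_ _ ] : [/\ mu.-integrable setT ((EFin \o w) \_ `]a, b[),
  [sequence \int[mu]_x `|(w x * window a b n x)%:E
    - ((EFin \o w) \_ `]a, b[) x| ]_n @ \oo --> 0 &
  [sequence \int[mu]_x (w x * window a b n x)%:E]_n @ \oo -->
     \int[mu]_x ((EFin \o w) \_ `]a, b[) x]%E.
  apply: (@dominated_convergence _ _ _ mu setT _
    (fun n x => (w x * window a b n x)%:E) _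
    ((abse \o (EFin \o w)) \_ `]a, b[)) => //.
  - by move=> n; exact: measurable_int (iwn n).
  - exact: measurable_int ((integrable_mkcond _ mI).1 iw).
  - apply: aeW => x _.
    rewrite (_ : ((EFin \o w) \_ `]a, b[) x = (w x * \1_(`]a, b[) x)%:E).
      apply: cvg_EFin; first by apply: nearW.
      by apply: cvgMr; apply: window_cvg; exact: ltW.
    by rewrite patchE indicE; case: ifPn => _; rewrite ?mulr1 ?mulr0.
  - apply: aeW => x n _; rewrite patchE /=.
    have [|xab] := ifPn; last first.
      rewrite window_out ?mulr0 ?normr0//; first exact: ltW.
      by move: xab; rewrite notin_setE /= in_itv /= => /negP.
    rewrite lee_fin normrM ler_piMr//.
    by have /andP[w1 w2] := window_bound a b n x (ltW ab); rewrite ger0_norm.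
rewrite -integral_mkcond => h.
have h0 : (fun n => \int[mu]_x (w x * window a b n x)%:E)%E = (fun=> 0%E).
  apply/funext => n; rewrite -[LHS]fineK ?integrable_fin_num ?iwn//.
  by congr EFin; exact: w0 (window_test_function a b n).
rewrite h0 in h; apply: esym; exact: cvg_unique (@cvg_cst _ _ _ _ _) h.
Qed.

(** The primitives of w vanish by the previous lemma, and almost every point is a
Lebesgue point, where w is the derivative of its primitive. *)
Lemma fundamental_lemma w : locally_integrable setT w ->
  (forall phi, test_function phi -> \int[mu]_x (w x * phi x) = 0) ->
  {ae mu, forall x, w x = 0}.
Proof.
move=> lw w0.
have := lebesgue_differentiation lw.
apply: filterS; first exact: (ae_filter_ringOfSetsType mu).
move=> x wx.
have ri : mu.-integrable `]x - 1, x + 1] (EFin \o w).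
  apply: integrableS (locally_integrable_segment w (x - 1) (x + 1) lw) => //.
  exact: subset_itv_oc_cc.
have xx : x < x + 1 by rewrite ltrDl.
have xx' : (BRight (x - 1) < BRight x)%O by rewrite bnd_simp ltrBlDr.
have [_ <-] := @FTC1_lebesgue_pt R w (BRight (x - 1)) x (x + 1) xx ri xx' wx.
rewrite (_ : (fun _ => _) = cst 0) ?derive1_cst//.
apply/funext => y; rewrite -Rintegral_itv_bndo_bndc.
  by rewrite /Rintegral fundamental_lemma_itv.
apply: integrableS (locally_integrable_segment w (x - 1) y lw) => //.
exact: subset_itv_oo_cc.
Qed.

End FundamentalLemma.

(** * Weak derivatives of test functions *)

Section WeakDerivatives.
Context {R : realType}.
Local Notation mu := (@lebesgue_measure R).
Implicit Types (f g u v w phi : R -> R) (M a b : R).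

Lemma continuous_locally_integrable M f : continuous f -> vanish_off M f ->
  locally_integrable setT f.
Proof.
move=> cf fM; apply: open_integrable_locally; first exact: openT.
exact: continuous_integrable cf fM.
Qed.

Lemma Rintegral_vanish_off M f : vanish_off M f ->
  \int[mu]_x f x = \int[mu]_(x in `[- M, M]) f x.
Proof.
move=> fM; rewrite [RHS]Rintegral_mkcond; apply: eq_Rintegral => x _.
rewrite patchE; case: ifPn => //= /negP xM.
rewrite fM// leNgt; apply/negP => /ltW; rewrite ler_norml => xM'.
by apply: xM; rewrite inE /= in_itv.
Qed.

Lemma derivable_LRcontinuous f a b : (forall x, derivable f x 1) ->
  derivable_oo_LRcontinuous f a b.
Proof.
move=> df; have cf := derivable_continuous _ df.
by split=> //; [apply: cvg_at_right_filter|apply: cvg_at_left_filter]; exact: cf.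
Qed.

Lemma test_function_is_weak_derivative u : test_function u ->
  is_weak_derivative u (derive1 u).
Proof.
move=> tu; have su := test_function_smooth _ tu.
have [M [M0 uM u'M]] := test_function_vanish _ tu.
have cu := smooth_continuous _ su.
have cu' := smooth_continuous _ (smooth_derive1 _ su).
split; [exact: continuous_locally_integrable uM|
        exact: continuous_locally_integrable u'M|].
move=> phi tphi; have sphi := test_function_smooth _ tphi.
have cphi' := smooth_continuous _ (smooth_derive1 _ sphi).
rewrite (Rintegral_vanish_off M); last by move=> x /uM ->; rewrite mul0r.
rewrite (@Rintegration_by_parts _ u phi (derive1 u) (derive1 phi)).
- rewrite !uM ?normrN ?(ger0_norm (ltW M0))//.
  rewrite !mul0r subrr sub0r -Rintegral_vanish_off//.
  by move=> x /u'M ->; rewrite mul0r.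
- by rewrite (lt_trans _ M0)// oppr_lt0.
- exact: continuous_subspaceT.
- by apply: derivable_LRcontinuous; exact: smooth_derivable.
- by [].
- exact: continuous_subspaceT.
- by apply: derivable_LRcontinuous; exact: smooth_derivable.
- by [].
Qed.

Lemma weak_derivative_unique u v1 v2 :
  is_weak_derivative u v1 -> is_weak_derivative u v2 -> ae_eq mu setT v1 v2.
Proof.
move=> [_ l1 h1] [_ l2 h2].
have := @fundamental_lemma R (v1 \- v2)%R (locally_integrableB l1 l2).
have h phi : test_function phi -> \int[mu]_x ((v1 \- v2)%R x * phi x) = 0.
  move=> tphi; have [M [_ pM _]] := test_function_vanish _ tphi.
  have cphi := smooth_continuous _ (test_function_smooth _ tphi).
  under eq_Rintegral do rewrite mulrBl.
  have i1 := locally_integrable_mul _ _ _ l1 cphi pM.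
  have i2 := locally_integrable_mul _ _ _ l2 cphi pM.
  rewrite RintegralB//.
  have := h1 _ tphi; rewrite h2// => /oppr_inj ->; exact: subrr.
move=> /(_ h); apply: filterS; first exact: (ae_filter_ringOfSetsType mu).
by move=> x /= /subr0_eq ->.
Qed.

(** The chosen weak derivative is only determined up to null sets; this relates it
to the classical derivative. *)
Lemma weak_derivative_test_function u : test_function u ->
  is_weak_derivative u (weak_derivative u) /\
  ae_eq mu setT (weak_derivative u) (derive1 u).
Proof.
move=> /test_function_is_weak_derivative wu.
have wdu : is_weak_derivative u (weak_derivative u).
  exact: (@xgetPex _ (cst 0) [set v | is_weak_derivative u v]
            (ex_intro _ _ wu)).
by split=> //; exact: weak_derivative_unique wdu wu.
Qed.

Lemma ae_eq_integral_sqr v w : measurable_fun setT v -> measurable_fun setT w ->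
  ae_eq mu setT v w ->
  (\int[mu]_x (v x ^+ 2)%:E = \int[mu]_x (w x ^+ 2)%:E)%E.
Proof.
move=> mv mw vw; apply: ae_eq_integral => //.
- by apply/measurable_EFinP; exact: measurable_funX.
- by apply/measurable_EFinP; exact: measurable_funX.
- move: vw; apply: filterS.
  by move=> x /= h _; rewrite h.
Qed.

Lemma Lnorm2E f :
  'N[mu]_2%:E[EFin \o f]%E = ((\int[mu]_x (f x ^+ 2)%:E) `^ 2^-1)%E.
Proof.
rewrite unlock; congr (_ `^ _)%E; apply: eq_integral => x _ /=.
by rewrite powR_mulrn// real_normK ?num_real.
Qed.

Lemma Lfun2I f : measurable_fun setT f ->
  (\int[mu]_x (f x ^+ 2)%:E < +oo)%E -> f \in Lfun mu 2%:E.
Proof.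
move=> mf f2; rewrite inE; apply/andP; split; rewrite inE//=.
by rewrite /finite_norm Lnorm2E poweR_lty.
Qed.

Lemma continuous_sqr_integrable M f g : continuous f -> continuous g ->
  vanish_off M f -> mu.-integrable setT (EFin \o (fun x => g x * f x ^+ 2)).
Proof.
move=> cf cg fM; apply: (continuous_integrable M); last first.
  by move=> x /fM ->; rewrite expr0n mulr0.
move=> x; apply: cvgM; first exact: cg.
apply: (@continuous_comp _ _ _ f (fun y : R => y ^+ 2)); first exact: cf.
exact: exprn_continuous.
Qed.

Lemma continuous_sqr_integrable1 M f : continuous f ->
  vanish_off M f -> mu.-integrable setT (EFin \o (fun x => f x ^+ 2)).
Proof.
move=> cf fM.
rewrite (_ : (fun _ => _) = (fun x => cst 1 x * f x ^+ 2)).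
  exact: (@continuous_sqr_integrable M f (cst 1) cf (fun=> cvg_cst _) fM).
by apply/funext => x; rewrite /= mul1r.
Qed.

Lemma test_function_X1 u : test_function u -> \int[mu]_x u x ^+ 2 = 1 -> X1 u.
Proof.
move=> tu u1; have su := test_function_smooth _ tu.
have [M [M0 uM u'M]] := test_function_vanish _ tu.
have cu := smooth_continuous _ su.
have cu' := smooth_continuous _ (smooth_derive1 _ su).
have [wu wuE] := weak_derivative_test_function _ tu.
have iu := continuous_sqr_integrable1 _ _ cu uM.
have iu' := continuous_sqr_integrable1 _ _ cu' u'M.
split; [split; [split|]|].
- apply: Lfun2I; first exact: continuous_measurable_fun.
  exact: integrable_lty iu.
- by exists (weak_derivative u).
- have mw : measurable_fun setT (weak_derivative u) by case: wu => _ [].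
  apply: Lfun2I => //.
  rewrite (ae_eq_integral_sqr _ (derive1 u))//.
    exact: integrable_lty iu'.
  exact: continuous_measurable_fun.
- apply: integrable_lty => //.
  exact: (continuous_sqr_integrable M u (fun x => `|x|) cu (@norm_continuous _ _) uM).
- rewrite Lnorm2E -[X in (X `^ _)%E]fineK; last exact: integrable_fin_num iu.
  by rewrite [fine _]u1 poweR_EFin powR1.
Qed.

Lemma kinetic_test_function u : test_function u ->
  \int[mu]_x (`|weak_derivative u x| ^+ 2) = \int[mu]_x (derive1 u x ^+ 2).
Proof.
move=> tu; have [[_ [mw _ _] _] wuE] := weak_derivative_test_function _ tu.
under eq_Rintegral do rewrite real_normK ?num_real//.
rewrite /Rintegral (ae_eq_integral_sqr _ (derive1 u))//; apply: continuous_measurable_fun.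
by apply: smooth_continuous; apply: smooth_derive1; exact: test_function_smooth.
Qed.

End WeakDerivatives.

(** * A unit bump, and the Coulomb potential of a density *)

Section SeparatedBumps.
Context {R : realType}.
Local Notation mu := (@lebesgue_measure R).
Implicit Types (f g u phi : R -> R) (M a b c L z : R).

(** Translation invariance, obtained as a change of variables with derivative 1. *)
Lemma Rintegral_shift g c : continuous g -> (forall x, 0 <= g x) ->
  \int[mu]_x g (x - c) = \int[mu]_x g x.
Proof.
move=> cg g0.
have dF (x : R) : is_derive x (1 : R) (fun x : R => x - c) (1 : R).
  by rewrite -[X in is_derive _ _ _ X]subr0; apply: is_deriveB.
have F'E : derive1 (fun x : R => x - c) = cst 1.
  by apply/funext => x; rewrite derive1E derive_val.
rewrite /Rintegral; congr fine; apply: esym.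
rewrite (@increasing_ge0_integration_by_substitutionT _ (fun x => x - c) g)//.
- by apply: eq_integral => x _; rewrite F'E mulrfctE /= mulr1.
- by move=> x y xy; rewrite ltrD2r.
- by rewrite F'E => x; exact: cvg_cst.
- by rewrite F'E; exact: is_cvg_cst.
- by rewrite F'E; exact: is_cvg_cst.
- apply/cvgrNyPle => A; near=> x; rewrite lerBlDr; near: x.
  apply: nbhs_ninfty_le; exact: num_real.
- apply/cvgryPge => A; near=> x; rewrite lerBrDr; near: x.
  apply: nbhs_pinfty_ge; exact: num_real.
Unshelve. all: by end_near.
Qed.

Lemma vanish_off_poly_bump (p : {poly R}) (k : nat) x :
  1 <= `|x| -> poly_bump p k (1 - 'X^2) x = 0.
Proof.
move=> x1; rewrite /poly_bump flat_le0 ?mulr0// !hornerE /= subr_le0.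
by rewrite -[x ^+ 2]real_normK ?num_real// expr_ge1.
Qed.

(** On [0, 1/2] the polynomial 1 - x^2 is at least 3/4, which bounds the bump
below by a positive constant there. *)
Lemma standard_bump_mass_gt0 :
  0 < \int[mu]_x (poly_bump 1 0 (1 - 'X^2 : {poly R}) x ^+ 2).
Proof.
set f := poly_bump _ _ _.
have cf : continuous f by apply: smooth_continuous; exact: smooth_poly_bump.
have fi := continuous_sqr_integrable1 _ _ cf (@vanish_off_poly_bump 1 0).
pose e : R := expR (- (3 / 4)^-1) ^+ 2.
have e0 : 0 < e by rewrite exprn_gt0// expR_gt0.
have mI : measurable (`[0, 2^-1]%classic : set (measurableTypeR R)).
  exact: measurable_itv.
apply: (@lt_le_trans _ _ (\int[mu]_x (e * \1_(`[0, 2^-1]%classic : set R) x))).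
  rewrite RintegralZl//; last exact: integrable_indic_itv.
  rewrite /Rintegral integral_indic// setIT /=.
  rewrite (lebesgue_measure_itv `[0, 2^-1]) /= lte_fin invr_gt0 ltr0n /= subr0.
  by rewrite mulr_gt0// invr_gt0.
apply: le_Rintegral => //.
- have := integrableZl measurableT e (integrable_indic_itv 0 2^-1 true false).
  by [].
- move=> x _; rewrite indicE mem_setE /= in_itv /=.
  have [/andP[x0 x2]|_] := boolP (0 <= x <= 2^-1); last by rewrite mulr0 sqr_ge0.
  have q0 : 3 / 4 <= 1 - x ^+ 2 by nra.
  have q1 : 0 < 1 - x ^+ 2 by rewrite (lt_le_trans _ q0)//; lra.
  rewrite mulr1 /e /f /poly_bump /flat !hornerE /= q1 expr0 invr1 !mul1r.
  rewrite ler_pXn2r ?nnegrE ?expR_ge0// ler_expR lerN2.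
  by rewrite lef_pV2 ?posrE//; lra.
Qed.

(** Normalising by a constant polynomial factor keeps the bump in the family, so
that its derivative vanishes off ]-1, 1[ for the same reason as the bump. *)
Lemma unit_bump_exists : exists phi, [/\ test_function phi, vanish_off 1 phi,
  vanish_off 1 (derive1 phi) & \int[mu]_x (phi x ^+ 2) = 1].
Proof.
pose q : {poly R} := 1 - 'X^2.
pose f := poly_bump 1 0 q.
pose N := \int[mu]_x (f x ^+ 2).
have N0 : 0 < N := standard_bump_mass_gt0.
exists (poly_bump (Num.sqrt N)^-1%:P 0 q); split.
- apply: (poly_bump_test_function _ _ _ 1) => x x1.
  rewrite !hornerE /= subr_le0.
  by rewrite -[x ^+ 2]real_normK ?num_real// expr_ge1.
- by move=> x; exact: vanish_off_poly_bump.
- move=> x x1; rewrite derive1E.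
  have h := is_derive_poly_bump (Num.sqrt N)^-1%:P 0 q x.
  by rewrite derive_val vanish_off_poly_bump.
- have cf : continuous f by apply: smooth_continuous; exact: smooth_poly_bump.
  have fi := continuous_sqr_integrable1 _ _ cf (@vanish_off_poly_bump 1 0).
  rewrite (_ : (fun _ => _) = (fun x => N^-1 * f x ^+ 2)).
    by rewrite RintegralZl// mulVf ?gt_eqF.
  apply/funext => x; rewrite /f /poly_bump hornerC.
  have -> : (1 : {poly R}).[x] = 1 by rewrite hornerE.
  rewrite mul1r exprMn.
  by rewrite exprVn sqr_sqrtr ?(ltW N0).
Qed.

(** Since L >= 2, no x satisfies both |x| < 1 and |x - L| < 1, so the cross term
vanishes. *)
Lemma separated_sqr g a b L x : vanish_off 1 g -> 2 <= L ->
  (a * g x + b * g (x - L)) ^+ 2 = a ^+ 2 * g x ^+ 2 + b ^+ 2 * g (x - L) ^+ 2.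
Proof.
move=> g1 L2; have [x1|x1] := leP 1 `|x|.
  by rewrite g1// mulr0 add0r expr0n mulr0 add0r exprMn.
rewrite (g1 (x - L)); first by rewrite mulr0 addr0 expr0n mulr0 addr0 exprMn.
have := lerB_dist L x; rewrite distrC => /(le_trans _); apply.
rewrite ger0_norm; last by lra.
by lra.
Qed.

Lemma abs_moment_integrable M u x : continuous u -> vanish_off M u ->
  mu.-integrable setT (EFin \o (fun y => `|x - y| * u y ^+ 2)).
Proof.
move=> cu uM; apply: (continuous_sqr_integrable M u (fun y => `|x - y|)) => //.
move=> y; apply: cvg_norm; apply: cvgB; [exact: cvg_cst|exact: cvg_id].
Qed.

(** The triangle inequality for x |-> |x - y| makes the potential Lipschitz, with
constant the total mass of u^2. *)
Lemma potential_continuous M u : continuous u -> vanish_off M u ->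
  continuous (fun x => \int[mu]_y (`|x - y| * u y ^+ 2)).
Proof.
move=> cu uM x; pose I := \int[mu]_y (u y ^+ 2).
have I0 : 0 <= I by apply: Rintegral_ge0 => y _; exact: sqr_ge0.
have iu := continuous_sqr_integrable1 _ _ cu uM.
have iM t := abs_moment_integrable M u t cu uM.
have lip t : `|\int[mu]_y (`|x - y| * u y ^+ 2) -
               \int[mu]_y (`|t - y| * u y ^+ 2)| <= `|x - t| * I.
  rewrite -RintegralB// -RintegralZl//.
  apply: (le_trans (le_normr_Rintegral measurableT (integrableB measurableT (iM x) (iM t)))).
  apply: le_Rintegral => //.
  - exact: integrable_norm (integrableB measurableT (iM x) (iM t)).
  - exact: (integrableZl measurableT `|x - t| iu).
  move=> y _; rewrite -mulrBl normrM [X in _ * X]ger0_norm ?sqr_ge0//.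
  rewrite ler_wpM2r ?sqr_ge0//.
  by rewrite (le_trans (ler_dist_dist _ _))// opprB addrA subrK.
apply/cvgrPdist_le => e e0; near=> t.
rewrite (le_trans (lip t))//.
have : `|x - t| <= e / (I + 1).
  near: t; apply: (@cvgr_dist_le _ _ _ _ _ id); first exact: cvg_id.
  by rewrite divr_gt0// ltr_wpDl.
rewrite ler_pdivlMr ?ltr_wpDl// => /(le_trans _); apply.
by rewrite ler_wpM2l// lerDl.
Unshelve. all: by end_near. Qed.

(** A real integral is monotone only on integrable functions, so the outer
integrand of the interaction has to be known integrable before it is bounded
from below. *)
Lemma interaction_integrable M u : continuous u -> vanish_off M u ->
  mu.-integrable setT
    (EFin \o (fun x => \int[mu]_y (`|x - y| * u x ^+ 2 * u y ^+ 2))).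
Proof.
move=> cu uM.
rewrite (_ : (fun _ => _) =
  (fun x => (\int[mu]_y (`|x - y| * u y ^+ 2)) * u x ^+ 2)); last first.
  apply/funext => x; rewrite mulrC -RintegralZl//.
    by apply: eq_Rintegral => y _; rewrite mulrAC mulrC.
  exact: abs_moment_integrable cu uM.
apply: continuous_sqr_integrable (uM) => //.
exact: potential_continuous uM.
Qed.

End SeparatedBumps.

(** * Energy of two separated lumps *)

Section Energy.
Context {R : realType}.
Local Notation mu := (@lebesgue_measure R).
Implicit Types (f g u phi : R -> R) (M a b c L z : R).

Lemma vanish_off_shift M c f :
  vanish_off M f -> vanish_off (M + `|c|) (fun x => f (x - c)).
Proof.
move=> fM x xM; apply: fM; have := lerB_dist x c.
by apply: le_trans; rewrite lerBrDr.
Qed.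

Lemma continuous_shift c f : continuous f -> continuous (fun x => f (x - c)).
Proof.
move=> cf x; apply: (@continuous_comp _ _ _ (fun x => x - c) f); last exact: cf.
by apply: cvgB; [exact: cvg_id|exact: cvg_cst].
Qed.

Lemma sqr_shift_integrable M c f : continuous f -> vanish_off M f ->
  mu.-integrable setT (EFin \o (fun x => f (x - c) ^+ 2)).
Proof.
move=> cf fM; apply: (continuous_sqr_integrable1 (M + `|c|) (fun x => f (x - c))).
  exact: continuous_shift.
exact: vanish_off_shift.
Qed.

Lemma Rintegral_sqr_shift c f : continuous f ->
  \int[mu]_x f (x - c) ^+ 2 = \int[mu]_x f x ^+ 2.
Proof.
move=> cf; apply: (Rintegral_shift (fun x => f x ^+ 2)) => x; last exact: sqr_ge0.
apply: (@continuous_comp _ _ _ f (fun y : R => y ^+ 2)); first exact: cf.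
exact: exprn_continuous.
Qed.

Lemma Rintegral_sqr_comb f L (s t : R) : continuous f -> vanish_off 1 f ->
  \int[mu]_x (s * f x ^+ 2 + t * f (x - L) ^+ 2) =
  (s + t) * \int[mu]_x f x ^+ 2.
Proof.
move=> cf f1.
have i1 := continuous_sqr_integrable1 _ _ cf f1.
have i2 := sqr_shift_integrable _ L _ cf f1.
rewrite RintegralD//.
- by rewrite !RintegralZl// Rintegral_sqr_shift// -mulrDl.
- exact: (integrableZl measurableT s i1).
- exact: (integrableZl measurableT t i2).
Qed.

Lemma sqr_comb_integrable f L (s t : R) : continuous f -> vanish_off 1 f ->
  mu.-integrable setT (EFin \o (fun x => s * f x ^+ 2 + t * f (x - L) ^+ 2)).
Proof.
move=> cf f1.
have i1 := continuous_sqr_integrable1 _ _ cf f1.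
have i2 := sqr_shift_integrable _ L _ cf f1.
exact: (integrableD measurableT (integrableZl measurableT s i1)
                    (integrableZl measurableT t i2)).
Qed.

Lemma mass_separated f a b L : continuous f -> vanish_off 1 f ->
  2 <= L -> a ^+ 2 + b ^+ 2 = 1 ->
  \int[mu]_x (a * f x + b * f (x - L)) ^+ 2 = \int[mu]_x f x ^+ 2.
Proof.
move=> cf f1 L2 ab.
under eq_Rintegral do rewrite (separated_sqr _ _ _ _ _ f1 L2).
by rewrite Rintegral_sqr_comb// ab mul1r.
Qed.

(** A bound on a weight is only needed on the support of the bump. *)
Lemma ler_sqr_vanish f x (s t : R) : vanish_off 1 f ->
  (`|x| < 1 -> s <= t) -> s * f x ^+ 2 <= t * f x ^+ 2.
Proof.
move=> f1 st; have [/f1 ->|/st {}st] := leP 1 `|x|.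
  by rewrite expr0n !mulr0.
by rewrite ler_wpM2r// sqr_ge0.
Qed.

Section Pair.
Context (phi : R -> R) (a b L : R).
Context (tphi : test_function phi) (phi1 : vanish_off 1 phi).
Context (mphi : \int[mu]_x phi x ^+ 2 = 1).
Context (ab1 : a ^+ 2 + b ^+ 2 = 1) (L2 : 2 <= L).

Let u x := a * phi x + b * phi (x - L).

Let cphi : continuous phi.
Proof. by apply: smooth_continuous; exact: test_function_smooth. Qed.

Let tu : test_function u.
Proof. exact: test_function_comb. Qed.

Let cu : continuous u.
Proof. by apply: smooth_continuous; exact: test_function_smooth. Qed.

Let uM : vanish_off (1 + `|L|) u.
Proof.
move=> x xM; rewrite /u (vanish_off_shift 1 L _ phi1 x xM) phi1 ?mulr0 ?addr0//.
by rewrite (le_trans _ xM)// lerDl.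
Qed.

Let uE x : u x ^+ 2 = a ^+ 2 * phi x ^+ 2 + b ^+ 2 * phi (x - L) ^+ 2.
Proof. exact: separated_sqr. Qed.

Lemma pair_X1 : X1 u.
Proof. by apply: test_function_X1 => //; rewrite mass_separated. Qed.

Lemma pair_kinetic : vanish_off 1 (derive1 phi) ->
  \int[mu]_x (`|weak_derivative u x| ^+ 2) = \int[mu]_x (derive1 phi x ^+ 2).
Proof.
move=> phi'1; rewrite (kinetic_test_function u tu).
have sphi := test_function_smooth _ tphi.
rewrite derive1_comb; [|exact: smooth_derivable..].
rewrite mass_separated//.
by apply: smooth_continuous; exact: smooth_derive1.
Qed.

(** On the support of the first lump |x| <= 1, and on that of the second
| |x| - L | <= 1; the errors add up to (a^2 + b^2)|z|. *)
Lemma pair_moment z :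
  z * \int[mu]_x (`|x| * u x ^+ 2) <= `|z| + b ^+ 2 * (z * L).
Proof.
have im : mu.-integrable setT (EFin \o (fun x => `|x| * u x ^+ 2)).
  exact: (continuous_sqr_integrable _ _ (fun x => `|x|) cu (@norm_continuous _ _) uM).
rewrite -RintegralZl//.
have -> : `|z| + b ^+ 2 * (z * L) =
  \int[mu]_x ((a ^+ 2 * `|z|) * phi x ^+ 2 +
              (b ^+ 2 * (z * L + `|z|)) * phi (x - L) ^+ 2).
  by rewrite Rintegral_sqr_comb// mphi mulr1 -[in LHS](mul1r `|z|) -ab1; ring.
apply: le_Rintegral => //.
- exact: (integrableZl measurableT z im).
- exact: sqr_comb_integrable.
move=> x _; rewrite uE.
have h1 : (z * `|x|) * phi x ^+ 2 <= `|z| * phi x ^+ 2.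
  apply: ler_sqr_vanish => // x1; rewrite (le_trans (ler_norm _))//.
  by rewrite normrM normr_id ler_piMr// ltW.
have h2 : (z * `|x|) * phi (x - L) ^+ 2 <= (z * L + `|z|) * phi (x - L) ^+ 2.
  apply: ler_sqr_vanish => // x1; rewrite -lerBlDl -mulrBr.
  rewrite (le_trans (ler_norm _))// normrM ler_piMr//.
  rewrite (le_trans _ (ltW x1))// -[in `|x| - L](ger0_norm (_ : 0 <= L)).
    exact: ler_dist_dist.
  by rewrite (le_trans _ L2).
rewrite (_ : z * _ = a ^+ 2 * (z * `|x| * phi x ^+ 2) +
  b ^+ 2 * (z * `|x| * phi (x - L) ^+ 2)); last by ring.
by apply: lerD; rewrite -[leRHS]mulrA ler_wpM2l ?sqr_ge0.
Qed.

(** Points of different lumps are at distance at least L - 2, and each of the two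
orders of the pair of lumps has mass a^2 b^2; the interactions of a lump with
itself are nonnegative and are dropped. *)
Lemma pair_interaction :
  2 * (a ^+ 2 * b ^+ 2 * (L - 2)) <=
  \int[mu]_x (\int[mu]_y (`|x - y| * u x ^+ 2 * u y ^+ 2)).
Proof.
pose A x := a ^+ 2 * phi x ^+ 2; pose B x := b ^+ 2 * phi (x - L) ^+ 2.
have A0 x : 0 <= A x by rewrite mulr_ge0 ?sqr_ge0.
have B0 x : 0 <= B x by rewrite mulr_ge0 ?sqr_ge0.
have AB x y : (L - 2) * (A x * B y) <= `|x - y| * (A x * B y).
  have [x1|x1] := leP 1 `|x|.
    by rewrite /A phi1// expr0n mulr0 mul0r !mulr0.
  have [y1|y1] := leP 1 `|y - L|.
    by rewrite /B phi1// expr0n !mulr0.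
  apply: ler_wpM2r; first exact: mulr_ge0.
  rewrite distrC (le_trans _ (ler_norm _))//.
  move: x1 y1; rewrite !ltr_norml => /andP[? ?] /andP[? ?]; lra.
(* A separable minorant of the integrand: its integral needs only the
   masses of the two lumps. *)
pose lo x y := (L - 2) * (A x * B y + B x * A y).
have lole x y : lo x y <= `|x - y| * u x ^+ 2 * u y ^+ 2.
  have h1 := AB x y; have := AB y x; rewrite distrC => h2.
  have p1 : 0 <= `|x - y| * (A x * A y).
    exact: mulr_ge0 (normr_ge0 _) (mulr_ge0 (A0 x) (A0 y)).
  have p2 : 0 <= `|x - y| * (B x * B y).
    exact: mulr_ge0 (normr_ge0 _) (mulr_ge0 (B0 x) (B0 y)).
  by rewrite /lo !uE -/(A x) -/(B x) -/(A y) -/(B y); nra.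
have loE x y : lo x y =
  ((L - 2) * B x * a ^+ 2) * phi y ^+ 2 +
  ((L - 2) * A x * b ^+ 2) * phi (y - L) ^+ 2.
  by rewrite /lo {2}/A {1}/B; ring.
have lo_int x : \int[mu]_y lo x y =
    ((L - 2) * a ^+ 2 * b ^+ 2) * phi x ^+ 2 +
    ((L - 2) * a ^+ 2 * b ^+ 2) * phi (x - L) ^+ 2.
  under eq_Rintegral do rewrite loE.
  by rewrite Rintegral_sqr_comb// mphi /A /B; ring.
have -> : 2 * (a ^+ 2 * b ^+ 2 * (L - 2)) = \int[mu]_x \int[mu]_y lo x y.
  under eq_Rintegral do rewrite lo_int.
  by rewrite Rintegral_sqr_comb// mphi; ring.
apply: le_Rintegral => //.
- by rewrite (funext lo_int); exact: sqr_comb_integrable.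
- exact: interaction_integrable uM.
move=> x _; apply: le_Rintegral => //.
- by rewrite (funext (loE x)); exact: sqr_comb_integrable.
- rewrite (_ : (fun _ => _) = (fun y => u x ^+ 2 * (`|x - y| * u y ^+ 2))).
    exact: (integrableZl measurableT (u x ^+ 2) (abs_moment_integrable _ _ x cu uM)).
  by apply/funext => y; rewrite [RHS]mulrCA mulrA.
Qed.

Lemma pair_energy z : vanish_off 1 (derive1 phi) ->
  energy z u <= \int[mu]_x (derive1 phi x ^+ 2) + `|z| + 2
                - b ^+ 2 * (a ^+ 2 - z) * L.
Proof.
move=> phi'1; rewrite /energy pair_kinetic//.
have := pair_interaction; have := pair_moment z.
set I := \int[mu]_x (\int[mu]_y _); set K := \int[mu]_x _ ^+ 2.
set P := \int[mu]_x _ => hP hI.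
have a0 := sqr_ge0 a; have b0 := sqr_ge0 b.
have a1 : a ^+ 2 * b ^+ 2 <= 1.
  by rewrite mulr_ile1//; move: ab1 a0 b0; lra.
lra.
Qed.

End Pair.

End Energy.

Theorem mainTheorem4 (R : realType) (z : R) (hz : z < 1) :
  ~ has_lbound (energy z @` X1) /\
  ~ (exists2 u : R -> R, X1 u & forall w : R -> R, X1 w -> energy z u <= energy z w).
Proof.
have unbounded : ~ has_lbound (energy z @` X1).
  move=> [m lbm].
  have [phi [tphi phi1 phi'1 mphi]] := @unit_bump_exists R.
  set K := \int[lebesgue_measure]_x (derive1 phi x ^+ 2).
  (* t is the mass b^2 of the far lump: t <= 1/2 makes a^2 = 1 - t positive,
     and t <= (1 - z)/2 gives a^2 - z >= (1 - z)/2. *)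
  pose t : R := Num.min 2^-1 ((1 - z) / 2).
  have t0 : 0 < t by rewrite lt_min; apply/andP; split; lra.
  have tz : t <= (1 - z) / 2 by rewrite ge_min lexx orbT.
  have t1 : t <= 2^-1 by rewrite ge_min lexx.
  pose a := Num.sqrt (1 - t); pose b := Num.sqrt t.
  have a2 : a ^+ 2 = 1 - t by rewrite sqr_sqrtr//; lra.
  have b2 : b ^+ 2 = t by rewrite sqr_sqrtr//; lra.
  have ab1 : a ^+ 2 + b ^+ 2 = 1 by rewrite a2 b2 subrK.
  pose D := t * ((1 - z) / 2).
  have D0 : 0 < D by rewrite mulr_gt0//; lra.
  (* D is a lower bound for the rate of decrease in L, and L is taken so
     large that the upper bound K + |z| + 2 - D L is at most m - 1. *)
  pose L := Num.max 2 ((K + `|z| + 3 - m) / D).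
  have L2 : 2 <= L by rewrite le_max lexx.
  have LD : K + `|z| + 3 - m <= L * D.
    by rewrite -ler_pdivrMr// le_max lexx orbT.
  have := lbm _ (imageP (energy z) (pair_X1 _ _ _ _ tphi phi1 mphi ab1 L2)).
  have := pair_energy _ _ _ _ tphi phi1 mphi ab1 L2 z phi'1.
  rewrite -/K a2 b2 => h1 h2.
  have h3 : L * D <= t * (1 - t - z) * L.
    rewrite mulrC ler_wpM2r//; first lra.
    by rewrite /D ler_wpM2l//; lra.
  by lra.
split=> // -[u Xu umin]; apply: unbounded; exists (energy z u).
by move=> _ [w Xw <-]; exact: umin.
Qed.
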